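(* Let $m,n,N\ge 1$. For a fixed $m\times n$ complex matrix $U=(u_{ij})$, the operator square-sum identity $$\sum_{i=1}^m\left|\sum_{j=1}^n u_{ij}A_j\right|_{\mathrm{qsym}}^{2}=\sum_{j=1}^n|A_j|_{\mathrm{qsym}}^{2}$$ holds for all $A_1,\ldots,A_n\in\mathbb{M}_N$ if and only if $U$ is an isometry, that is, $U^*U=I_n$.
   Context: $\mathbb{M}_N$ is the space of $N\times N$ complex matrices. For $Z\in\mathbb{M}_N$, the quadratic symmetric modulus is $|Z|_{\mathrm{qsym}}=\left(\frac{Z^*Z+ZZ^*}{2}\right)^{1/2}$. *)

(* Defs.v *)
From mathcomp Require Import all_boot all_order all_algebra.
From mathcomp Require Import complex.
From mathcomp Require Import reals.

Set Implicit Arguments.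
Unset Strict Implicit.
Unset Printing Implicit Defensive.

Import GRing.Theory Num.Theory.
Local Open Scope ring_scope.
Local Open Scope sesquilinear_scope.

(* Square root by spectral calculus: [spectralmx A] is unitary, and when [A] is
   normal [A = invmx P *m diag_mx (spectral_diag A) *m P] with
   [P = spectralmx A].  For positive semidefinite [A] the eigenvalues are
   nonnegative, [sqrtC] is the nonnegative root, and [sqrtmx A] is the positive
   semidefinite square root.  It is only meaningful for normal [A]. *)
Definition sqrtmx (C : numClosedFieldType) (N : nat) (A : 'M[C]_N) : 'M[C]_N :=
  invmx (spectralmx A) *m diag_mx (map_mx sqrtC (spectral_diag A))
    *m spectralmx A.

Definition qsym (C : numClosedFieldType) (N : nat) (Z : 'M[C]_N) : 'M[C]_N :=
  sqrtmx (2%:R^-1 *: (Z^t* *m Z + Z *m Z^t*)).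

(* Main.v *)
Require Import Defs.
From mathcomp Require Import all_boot all_order all_algebra.
From mathcomp Require Import complex.
From mathcomp Require Import reals.

(** With [G = U^* U], the left-hand side expands to
    [1/2 sum_(j,k) (G j k *: A_j^* A_k + G k j *: A_j A_k^* )], which gives one
    direction. For the converse, scalar matrices [A_j = c_j I] turn the identity
    into [c^* G c = c^* c] for every vector [c], and polarization yields
    [G = I]. *)

Import GRing.Theory Num.Theory.
Local Open Scope ring_scope.
Local Open Scope sesquilinear_scope.

Section NumClosed.
Variable C : numClosedFieldType.

Lemma trmxC_mul (m n p : nat) (A : 'M[C]_(m, n)) (B : 'M[C]_(n, p)) :
  (A *m B)^t* = B^t* *m A^t*.
Proof. by rewrite trmx_mul map_mxM. Qed.

Lemma trmxC_D (m n : nat) (A B : 'M[C]_(m, n)) : (A + B)^t* = A^t* + B^t*.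
Proof. by rewrite linearD map_mxD. Qed.

Lemma trmxC_Z (m n : nat) (a : C) (A : 'M[C]_(m, n)) :
  (a *: A)^t* = a^* *: A^t*.
Proof. by rewrite linearZ map_mxZ. Qed.

Lemma trmxC_sum (I : finType) (m n : nat) (A : I -> 'M[C]_(m, n)) :
  (\sum_i A i)^t* = \sum_i (A i)^t*.
Proof. by rewrite !raddf_sum. Qed.

(** The spectral theorem reduces the claim to the diagonal, where [sqrtCK] applies to every complex
    eigenvalue; normality is what makes [A] diagonalizable by [spectralmx A]. *)
Lemma sqrtmx_sq (N : nat) (A : 'M[C]_N) :
  A \is normalmx -> (sqrtmx A) ^+ 2 = A.
Proof.
move=> /orthomx_spectralP AE; rewrite expr2 -mulmxE {1 2}/sqrtmx.
rewrite -!mulmxA (mulmxA (spectralmx A) (invmx _)) mulmxV ?spectral_unit //.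
rewrite mul1mx (mulmxA (diag_mx _) (diag_mx _)) mulmx_diag.
rewrite [RHS]AE -!mulmxA; congr (_ *m (diag_mx _ *m _)).
by apply/rowP => i; rewrite !mxE -expr2 sqrtCK.
Qed.

Lemma qsym_sq (N : nat) (Z : 'M[C]_N) :
  (qsym Z) ^+ 2 = 2%:R^-1 *: (Z^t* *m Z + Z *m Z^t*).
Proof.
apply: sqrtmx_sq; apply/normalmxP.
(* A Hermitian matrix commutes with its adjoint, hence is normal. *)
suff -> : (2%:R^-1 *: (Z^t* *m Z + Z *m Z^t*))^t*
          = 2%:R^-1 *: (Z^t* *m Z + Z *m Z^t*) by [].
by rewrite trmxC_Z trmxC_D !trmxC_mul trmxCK fmorphV rmorph_nat.
Qed.

Lemma gramE (m n : nat) (U : 'M[C]_(m, n)) (j k : 'I_n) :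
  (U^t* *m U) j k = \sum_i (U i j)^* * U i k.
Proof. by rewrite mxE; apply: eq_bigr => i _; rewrite !mxE. Qed.

(** The Gram indices are swapped in the second term because in [Z *m Z^t*] the conjugate falls on
    the coefficient of the second factor. *)
Lemma sum_qsym_sq (m n N : nat) (U : 'M[C]_(m, n)) (A : 'I_n -> 'M[C]_N) :
  \sum_i (qsym (\sum_j U i j *: A j)) ^+ 2 =
  2%:R^-1 *: \sum_j \sum_k ((U^t* *m U) j k *: ((A j)^t* *m A k)
                           + (U^t* *m U) k j *: (A j *m (A k)^t*)).
Proof.
under eq_bigr do rewrite qsym_sq trmxC_sum !mulmx_suml -big_split /=.
rewrite -scaler_sumr exchange_big; congr (_ *: _); apply: eq_bigr => j _.
under eq_bigr do rewrite !mulmx_sumr -big_split /=.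
rewrite exchange_big; apply: eq_bigr => k _.
rewrite !gramE !scaler_suml -big_split; apply: eq_bigr => i _ /=.
rewrite !trmxC_Z -!scalemxAl -!scalemxAr !scalerA; congr (_ + _ *: _).
exact: mulrC.
Qed.

(** Complex polarization: the vectors [x + y] and [x + 'i *: y] control the sum and the difference
    of the two cross terms. *)
Lemma sesquilinear_form_eq0 (n : nat) (H : 'M[C]_n) :
  (forall c : 'cV[C]_n, c^t* *m H *m c = 0) -> H = 0.
Proof.
move=> H0.
have Hxy (x y : 'cV[C]_n) : x^t* *m H *m y = 0.
  have E1 := H0 (x + y).
  rewrite trmxC_D !mulmxDl !mulmxDr !H0 add0r addr0 in E1.
  have Ei := H0 (x + 'i *: y).
  rewrite trmxC_D trmxC_Z conjCi !mulmxDl !mulmxDr -!scalemxAl -!scalemxAr in Ei.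
  rewrite !H0 !scaler0 add0r addr0 scaleNr -scalerBr in Ei.
  (* The cross terms are equal by [Ei] and opposite by [E1], so twice each of them vanishes. *)
  move/eqP: Ei; rewrite scaler_eq0 (negPf (neq0Ci _)) subr_eq0 => /eqP Ei.
  move/eqP: E1; rewrite -Ei -mulr2n -scaler_nat scaler_eq0 pnatr_eq0 /=.
  by move/eqP.
apply/matrixP => j k; rewrite [RHS]mxE.
(* Basis vectors pick out the entry [H j k]. *)
have /matrixP/(_ 0 0) := Hxy (delta_mx j 0) (delta_mx k 0).
by rewrite trmx_delta map_delta_mx -rowE -colE !mxE.
Qed.

(** For the converse, the quadratic form of [U^t* *m U - 1%:M] vanishes identically, so polarization
    applies. *)
Lemma isometryP (m n : nat) (U : 'M[C]_(m, n)) :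
  U^t* *m U = 1%:M <->
  forall c : 'cV[C]_n, (U *m c)^t* *m (U *m c) = c^t* *m c.
Proof.
split=> [UU c|Uc]; first by rewrite trmxC_mul -mulmxA (mulmxA _ U) UU mul1mx.
apply/eqP; rewrite -subr_eq0; apply/eqP/sesquilinear_form_eq0 => c.
by rewrite mulmxBr mulmx1 mulmxBl mulmxA -trmxC_mul -mulmxA Uc subrr.
Qed.

Lemma qsym_scalar_sq (N : nat) (a : C) :
  (qsym (a%:M : 'M_N)) ^+ 2 = (a^* * a)%:M.
Proof.
rewrite qsym_sq tr_scalar_mx map_scalar_mx -!scalar_mxM (mulrC a) -mulr2n.
by rewrite -scaler_nat scalerA mulVf ?scale1r // pnatr_eq0.
Qed.

Lemma sum_qsym_sq_isometry (m n N : nat) (U : 'M[C]_(m, n)) : (0 < N)%N ->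
  (forall A : 'I_n -> 'M[C]_N,
      \sum_i (qsym (\sum_j U i j *: A j)) ^+ 2 = \sum_j (qsym (A j)) ^+ 2)
  <-> U^t* *m U = 1%:M.
Proof.
(* Writing the size as [N.+1] provides the entry at [0 0], from which a scalar matrix is read
   back. *)
case: N => // N _; split=> [qU|UU A].
  apply/isometryP => c; apply/matrixP => r s; rewrite !ord1 => {r s}.
  have /matrixP/(_ 0 0) := qU (fun j => (c j 0)%:M).
  have -> : \sum_i (qsym (\sum_j U i j *: (c j 0)%:M : 'M_N.+1)) ^+ 2
            = \sum_i (((U *m c) i 0)^* * (U *m c) i 0)%:M.
    apply: eq_bigr => i _; rewrite -qsym_scalar_sq mxE raddf_sum /=.
    by under eq_bigr do rewrite scale_scalar_mx.
  under [in RHS]eq_bigr do rewrite qsym_scalar_sq.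
  by rewrite !gramE !summxE; under eq_bigr do rewrite mxE eqxx;
     under [in RHS]eq_bigr do rewrite mxE eqxx.
(* With the identity as Gram matrix, only the terms [k = j] survive. *)
rewrite sum_qsym_sq UU scaler_sumr; apply: eq_bigr => j _.
rewrite qsym_sq (bigD1 j) //= big1 ?addr0 => [|k kj].
  by rewrite mxE eqxx !scale1r.
by rewrite !mxE (negPf kj) eq_sym (negPf kj) !scale0r addr0.
Qed.

End NumClosed.

Theorem theorem1p18 (R : realType) (m n N : nat) (hm : (1 <= m)%N)
    (hn : (1 <= n)%N) (hN : (1 <= N)%N) (U : 'M[R[i]]_(m, n)) :
  (forall A : 'I_n -> 'M[R[i]]_N,
      \sum_(i < m) (qsym (\sum_(j < n) U i j *: A j)) ^+ 2
      = \sum_(j < n) (qsym (A j)) ^+ 2)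
  <-> U^t* *m U = 1%:M.
Proof. exact: sum_qsym_sq_isometry. Qed.
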